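(* Let $G$ and $H$ be transitive permutation groups on finite sets $\Gamma$ and $\Delta$ respectively. Then the wreath product $G\wr H$ in its imprimitive action on $\Gamma\times\Delta$ is pre-primitive if and only if both $G$ and $H$ are pre-primitive.
   Context: A permutation group on $\Omega$ is a subgroup of $\mathrm{Sym}(\Omega)$, acting on the right. A partition of $\Omega$ is $G$-invariant if every $g\in G$ maps each part onto a part. The orbit partition of a subgroup is the partition of $\Omega$ into its orbits. A transitive permutation group $G$ on a finite set $\Omega$ is pre-primitive if every $G$-invariant partition of $\Omega$ is the orbit partition of some subgroup of $G$. The wreath product $G\wr H$ in its imprimitive action is the permutation group on $\Gamma\times\Delta$ generated by: the base group, i.e. the direct product of copies $G_\delta$ of $G$ indexed by $\delta\in\Delta$, where $G_\delta$ acts on $\Gamma_\delta=\{(\gamma,\delta):\gamma\in\Gamma\}$ as $G$ acts on $\Gamma$ and fixes all points outside $\Gamma_\delta$; and the top group, a copy of $H$ acting on the second coordinate of points of $\Gamma\times\Delta$. *)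

(* Defs.v *)
From HB Require Import structures.
From mathcomp Require Import all_boot all_fingroup.

Set Implicit Arguments.
Unset Strict Implicit.
Unset Printing Implicit Defensive.

Import GroupScope.

Section PrePrimitive.

Variables (T : finType) (G : {group {perm T}}).

Definition invariant_partition (P : {set {set T}}) : Prop :=
  partition P [set: T] /\ [acts G, on P | 'P^*].

Definition orbit_partition (K : {group {perm T}}) : {set {set T}} :=
  orbit 'P K @: [set: T].

(* MathComp transitivity on a set forces that set to be nonempty. *)
Definition pre_primitive : Prop :=
  [transitive G, on [set: T] | 'P]
  /\ forall P : {set {set T}}, invariant_partition P ->
       exists2 K : {group {perm T}}, K \subset G & P = orbit_partition K.

End PrePrimitive.

Section Wreath.

Variables (Gamma Delta : finType).

Definition fibre_fun (d : Delta) (g : {perm Gamma}) (x : Gamma * Delta) :=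
  if x.2 == d then (g x.1, x.2) else x.

Fact fibre_fun_inj d g : injective (fibre_fun d g).
Proof.
move=> [a u] [b v]; rewrite /fibre_fun /=.
case: (eqVneq u d) => [->|ud]; case: (eqVneq v d) => [->|vd] // [].
- by move/perm_inj->.
- by move=> _ dv; rewrite dv eqxx in vd.
- by move=> _ du; rewrite du eqxx in ud.
Qed.

Definition fibre_perm d g : {perm Gamma * Delta} := perm (@fibre_fun_inj d g).

Definition top_fun (h : {perm Delta}) (x : Gamma * Delta) := (x.1, h x.2).

Fact top_fun_inj h : injective (top_fun h).
Proof. by move=> [a u] [b v] [-> /perm_inj->]. Qed.

Definition top_perm h : {perm Gamma * Delta} := perm (@top_fun_inj h).

Definition fibre_copy (G : {group {perm Gamma}}) (d : Delta) :=
  [set fibre_perm d g | g in G].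

(* The copies have disjoint supports, so they commute and the group they
   generate is their direct product. *)
Definition base_group (G : {group {perm Gamma}}) : {group {perm Gamma * Delta}} :=
  <<\bigcup_(d : Delta) fibre_copy G d>>%G.

Definition top_group (H : {group {perm Delta}}) : {set {perm Gamma * Delta}} :=
  [set top_perm h | h in H].

Definition wreath (G : {group {perm Gamma}}) (H : {group {perm Delta}}) :
    {group {perm Gamma * Delta}} :=
  <<base_group G :|: top_group H>>%G.

End Wreath.

(* Main.v *)
Require Import Defs.
From mathcomp Require Import all_boot all_fingroup.

Set Implicit Arguments.
Unset Strict Implicit.
Unset Printing Implicit Defensive.

Import GroupScope.

(** Invariant partitions correspond to invariant equivalence relations [e], and
    among the subgroups of [G] whose orbits lie inside the classes of [e] there
    is a largest one, the kernel of the action of [G] on the classes.  So [e] is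
    an orbit partition exactly when that kernel moves any point to any point
    of its class; [pre_primitiveP] restates pre-primitivity in this way, and
    the rest of the proof only manipulates relations and single permutations.

    An element of the wreath product permutes the fibres by an element of [H]
    and carries each fibre onto its image by an element of [G] ([wreath_coord]).
    If [G wr H] is pre-primitive, an invariant relation on [Gamma] extends to the
    product, fibre by fibre, and one on [Delta] pulls back along the second
    projection; reading the witness in coordinates gives one in [G] or [H].

    Conversely let [E] be an invariant relation of [G wr H] and [E (x, u) (y, v)].
    If [u = v], the trace of [E] on that fibre is [G]-invariant, and the element
    that [G] provides can act on this fibre alone, fixing all other points.
    If [u <> v], moving only the points of the fibre over [v] shows that this
    fibre, hence every fibre, lies inside one class ([fibre_in_class]); then [E]
    is the pullback of an [H]-invariant relation, so that the first coordinate
    can be adjusted freely once [H] has corrected the second. *)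

(** * Pre-primitivity in terms of invariant relations *)

Section InvariantRelations.

Variables (T : finType) (G : {group {perm T}}).

Definition invariant_rel (e : rel T) : Prop :=
  equivalence_rel e /\ (forall g, g \in G -> forall x y, e x y -> e (g x) (g y)).

Definition kernel_transitive_on_classes (e : rel T) : Prop :=
  forall x y, e x y -> exists g, [/\ g \in G, g x = y & forall z, e z (g z)].

Lemma invariant_relE e g x y :
  invariant_rel e -> g \in G -> e (g x) (g y) = e x y.
Proof.
case=> _ inv Gg; apply/idP/idP; last exact: inv.
by move/(inv g^-1 (groupVr Gg)); rewrite !permK.
Qed.

Lemma invariant_rel_partition e :
  invariant_rel e -> invariant_partition G (equivalence_partition e [set: T]).
Proof.
move=> einv; split; first
    by apply: equivalence_partitionP => x y z _ _ _; apply: einv.1.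
set P := equivalence_partition e _.
have stableP g A : g \in G -> A \in P -> 'P^*%act A g \in P.
  move=> Gg /imsetP[x _ ->]; apply/imsetP; exists (g x) => //.
  apply/setP=> y; rewrite !inE /=; apply/imsetP/idP.
    by case=> z; rewrite !inE /= => exz ->; rewrite /aperm invariant_relE.
  move=> exy; exists (g^-1 y); last by rewrite /= /aperm permKV.
  by rewrite !inE -(invariant_relE x (g^-1 y) einv Gg) permKV.
apply/actsP=> g Gg A; apply/idP/idP=> [|/stableP->//].
by move/(stableP g^-1 _ (groupVr Gg)); rewrite actK.
Qed.

Lemma pblock_invariant_rel (P : {set {set T}}) :
  invariant_partition G P -> invariant_rel (fun x y => y \in pblock P x).
Proof.
case=> /and3P[/eqP covP tiP _] actP.
have inP z : z \in cover P by rewrite covP.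
split=> [x y z|g Gg x y].
  by split=> [|xy]; [rewrite mem_pblock | rewrite (same_pblock tiP xy)].
move=> xy; set A := pblock P x in xy.
have PA : A \in P by rewrite pblock_mem.
have PAg : 'P^*%act A g \in P by rewrite (actsP actP).
have gA z : z \in A -> g z \in 'P^*%act A g by move=> Az; apply: imset_f.
by rewrite (def_pblock tiP PAg (gA x _)) ?gA ?mem_pblock.
Qed.

(** The kernel of the action on a partition contains every subgroup whose orbits
    lie in the parts, so quantifying over subgroups amounts to asking that each
    pair of equivalent points is matched by one permutation of the kernel. *)
Lemma pre_primitiveP :
  pre_primitive G <->
  [transitive G, on [set: T] | 'P]
  /\ forall e, invariant_rel e -> kernel_transitive_on_classes e.
Proof.
split=> -[trG ppG]; split=> //; [move=> e einv x y exy | move=> P Pinv].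
  have [K sKG defP] := ppG _ (invariant_rel_partition einv).
  have eq_ez z : [set t | e z t] = orbit 'P K z.
    have zz : z \in [set t | e z t] by rewrite inE (einv.1 z z z).1.
    have: [set t | e z t] \in Defs.orbit_partition K.
      by rewrite -defP; apply/imsetP; exists z => //; apply/setP=> t; rewrite !inE.
    by case/imsetP=> t _ et; move: zz; rewrite et => /orbit_eqP ->.
  have: y \in orbit 'P K x by rewrite -eq_ez inE.
  case/orbitP=> k Kk kx; exists k; split=> [||z]; rewrite ?(subsetP sKG) //.
  by have := mem_orbit 'P z Kk; rewrite -eq_ez inE.
have [/and3P[/eqP covP tiP P0] _] := Pinv.
have inP z : z \in cover P by rewrite covP.
have kerP := ppG _ (pblock_invariant_rel Pinv).
(* The largest subgroup whose orbits lie in the parts. *)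
pose K := [group of 'C_G(P | 'P^* )].
have orbK x : orbit 'P K x = pblock P x.
  apply/setP=> y; apply/orbitP/idP.
    case=> k /setIP[_ /astabP fixP] <-.
    rewrite -(fixP (pblock P x)) ?pblock_mem //.
    by apply: imset_f; rewrite mem_pblock.
  case/kerP=> g [Gg gx gP]; exists g => //.
  (* A part sent into itself is fixed, by finiteness. *)
  rewrite inE Gg; apply/astabP=> A PA; apply/eqP.
  rewrite eqEcard card_imset ?leqnn ?andbT; last exact: act_inj.
  apply/subsetP=> _ /imsetP[z Az ->].
  by rewrite -(def_pblock tiP PA Az) gP.
exists K; first exact: subsetIl.
apply/setP=> A; apply/idP/imsetP=> [PA|[x _ ->]]; last by rewrite orbK pblock_mem.
have /set0Pn[x Ax] : A != set0 by apply: contraNneq P0 => <-.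
by exists x; rewrite // orbK (def_pblock tiP PA Ax).
Qed.

End InvariantRelations.

(** * Elements of the wreath product *)

Lemma perm_transitive (T : finType) (K : {group {perm T}}) (x y : T) :
  [transitive K, on [set: T] | 'P] -> exists2 k, k \in K & k x = y.
Proof.
by move=> trK; have [k Kk ->] := atransP2 trK (in_setT x) (in_setT y); exists k.
Qed.

Section WreathElements.

Variables (Gamma Delta : finType).
Variables (G : {group {perm Gamma}}) (H : {group {perm Delta}}).

Lemma fibre_permE (d : Delta) (g : {perm Gamma}) a u :
  fibre_perm d g (a, u) = if u == d then (g a, u) else (a, u).
Proof. by rewrite permE. Qed.

Lemma top_permE (h : {perm Delta}) (a : Gamma) u :
  top_perm Gamma h (a, u) = (a, h u).
Proof. by rewrite permE. Qed.

Lemma fibre_perm_wreath d g : g \in G -> fibre_perm d g \in wreath G H.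
Proof.
move=> Gg; apply/mem_gen/setUP; left; apply/mem_gen/bigcupP.
by exists d => //; apply: imset_f.
Qed.

Lemma top_perm_wreath h : h \in H -> top_perm Gamma h \in wreath G H.
Proof. by move=> Hh; apply/mem_gen/setUP; right; apply: imset_f. Qed.

Definition coord_set : {set {perm Gamma * Delta}} :=
  [set w : {perm Gamma * Delta} | [exists h in H, forall u, exists g in G, forall a,
              w (a, u) == (g a, h u : Delta)]].

Lemma coord_setP (w : {perm Gamma * Delta}) :
  reflect (exists2 h, h \in H &
             forall u, exists2 g, g \in G & forall a, w (a, u) = (g a, h u))
          (w \in coord_set).
Proof.
rewrite inE; apply: (iffP exists_inP) => -[h Hh wP]; exists h => //.
  move=> u; have /exists_inP[g Gg /forallP wg] := forallP wP u.
  by exists g => // a; apply/eqP.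
apply/forallP=> u; have [g Gg wg] := wP u.
by apply/exists_inP; exists g => //; apply/forallP=> a; apply/eqP.
Qed.

Lemma group_set_coord : group_set coord_set.
Proof.
apply/group_setP; split=> [|w1 w2 /coord_setP[h1 Hh1 w1P] /coord_setP[h2 Hh2 w2P]].
  by apply/coord_setP; exists 1 => // u; exists 1 => // a; rewrite !perm1.
apply/coord_setP; exists (h1 * h2) => [|u]; first exact: groupM.
have [g1 Gg1 w1g] := w1P u; have [g2 Gg2 w2g] := w2P (h1 u).
by exists (g1 * g2) => [|a]; rewrite ?groupM // !permM w1g w2g.
Qed.

(** The permutations of this shape form a group that contains the generators;
    the element of [G] may depend on the fibre, that of [H] may not. *)
Lemma wreath_coord (w : {perm Gamma * Delta}) : w \in wreath G H ->
  exists2 h, h \in H &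
    forall u, exists2 g, g \in G & forall a, w (a, u) = (g a, h u).
Proof.
move=> Ww; apply/coord_setP; apply: subsetP w Ww.
change (wreath G H \subset group group_set_coord).
rewrite gen_subG subUset gen_subG; apply/andP; split; apply/subsetP=> w.
  case/bigcupP=> d _ /imsetP[g Gg ->]; apply/coord_setP; exists 1 => // u.
  exists (if u == d then g else 1) => [|a]; first by case: ifP.
  by rewrite fibre_permE perm1; case: ifP; rewrite ?perm1.
case/imsetP=> h Hh ->; apply/coord_setP; exists h => // u.
by exists 1 => // a; rewrite top_permE perm1.
Qed.

Hypotheses (transG : [transitive G, on [set: Gamma] | 'P])
           (transH : [transitive H, on [set: Delta] | 'P]).

Lemma wreath_transitive : [transitive wreath G H, on [set: Gamma * Delta] | 'P].
Proof.
have /imsetP[a0 _ _] := transG; have /imsetP[u0 _ _] := transH.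
apply/imsetP; exists (a0, u0) => //; apply/esym/setP=> -[b v]; rewrite inE.
have [g Gg ga] := perm_transitive a0 b transG.
have [h Hh hu] := perm_transitive u0 v transH.
apply/orbitP; exists (fibre_perm u0 g * top_perm Gamma h).
  by rewrite groupM ?fibre_perm_wreath ?top_perm_wreath.
by rewrite /= /aperm permM fibre_permE eqxx top_permE ga hu.
Qed.

(** Since [u <> v], the group acting on the fibre over [v] alone fixes [(x, u)]
    and hence the class of [(x, u)], but moves [(y, v)] all over its fibre.
    The top group then carries this to every other fibre. *)
Lemma fibre_in_class (E : rel (Gamma * Delta)) x u y v :
  invariant_rel (wreath G H) E -> u != v -> E (x, u) (y, v) ->
  forall a b t, E (a, t) (b, t).
Proof.
move=> Einv uv Exy; have [eqE invE] := Einv.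
have Ev b : E (x, u) (b, v).
  have [g Gg <-] := perm_transitive y b transG.
  have := invE _ (fibre_perm_wreath v Gg) _ _ Exy.
  by rewrite !fibre_permE eqxx (negPf uv).
move=> a b t; have [h Hh <-] := perm_transitive v t transH.
rewrite -!top_permE (invariant_relE _ _ Einv (top_perm_wreath Hh)).
by rewrite -((eqE (x, u) (a, v) (b, v)).2 (Ev a)).
Qed.

End WreathElements.

(** * The equivalence *)

Section PrePrimitiveWreath.

Variables (Gamma Delta : finType).
Variables (G : {group {perm Gamma}}) (H : {group {perm Delta}}).
Hypotheses (transG : [transitive G, on [set: Gamma] | 'P])
           (transH : [transitive H, on [set: Delta] | 'P]).

(** Fibrewise [e] keeps the second coordinate, so a witness stays in the fibre it
    starts from and its [G]-coordinate there is a witness for [e]. *)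
Lemma pre_primitive_wreath_base : pre_primitive (wreath G H) -> pre_primitive G.
Proof.
case/pre_primitiveP=> _ ppW; apply/pre_primitiveP; split=> // e [eqe inve] x y exy.
have /imsetP[d _ _] := transH.
pose E : rel (Gamma * Delta) := fun p q => (p.2 == q.2) && e p.1 q.1.
have Einv : invariant_rel (wreath G H) E.
  split=> [[a r] [b s] [c t]|w Ww [a r] [b s]] /=.
    split=> [|/andP[/= /eqP-> eab]]; first by rewrite /E /= eqxx (eqe c c c).1.
    by rewrite /E /= ((eqe a b c).2 eab).
  case/andP=> /= /eqP-> eab; have [h _ wP] := wreath_coord Ww.
  by have [g Gg wg] := wP s; rewrite /E !wg /= eqxx inve.
have [|w [Ww wx wE]] := ppW E Einv (x, d) (y, d); first by rewrite /E /= eqxx.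
have [h _ /(_ d)[g Gg wg]] := wreath_coord Ww.
exists g; split=> // [|z]; first by move: wx; rewrite wg => -[].
by have := wE (z, d); rewrite wg => /andP[].
Qed.

Lemma pre_primitive_wreath_top : pre_primitive (wreath G H) -> pre_primitive H.
Proof.
case/pre_primitiveP=> _ ppW; apply/pre_primitiveP; split=> // e [eqe inve] u v euv.
have /imsetP[a0 _ _] := transG.
pose E : rel (Gamma * Delta) := fun p q => e p.2 q.2.
have Einv : invariant_rel (wreath G H) E.
  split=> [p q r|w Ww [a r] [b s]] /=; first exact: eqe.
  have [h Hh wP] := wreath_coord Ww => ers.
  by have [g _ ->] := wP r; have [g' _ ->] := wP s; apply: inve.
have [|w [Ww wu wE]] := ppW E Einv (a0, u) (a0, v); first exact: euv.
have [h Hh wP] := wreath_coord Ww.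
exists h; split=> // [|z]; first by move: wu; have [g _ ->] := wP u => -[].
by have := wE (a0, z); have [g _ ->] := wP z.
Qed.

Lemma pre_primitive_wreath :
  pre_primitive G -> pre_primitive H -> pre_primitive (wreath G H).
Proof.
case/pre_primitiveP=> _ ppG /pre_primitiveP[_ ppH].
apply/pre_primitiveP; split=> [|E Einv [x u] [y v] Exy].
  exact: wreath_transitive.
have [eqE invE] := Einv.
have [uv|uv] := eqVneq u v.
  rewrite -{}uv in Exy *.
  pose e : rel Gamma := fun a b => E (a, u) (b, u).
  have einv : invariant_rel G e.
    split=> [a b c|g Gg a b]; first exact: eqE.
    by move/(invE _ (fibre_perm_wreath H u Gg)); rewrite !fibre_permE eqxx.
  have [g [Gg gx ge]] := ppG e einv x y Exy.
  exists (fibre_perm u g); split=> [||[a t]]; first exact: fibre_perm_wreath.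
    by rewrite fibre_permE eqxx gx.
  by rewrite fibre_permE; case: eqP => [->|_]; [exact: ge | exact: (eqE _ (a, t) (a, t)).1].
have inclass := fibre_in_class transG transH Einv uv Exy.
pose e : rel Delta := fun s t => E (x, s) (x, t).
(* Fibres lie inside classes, so [E] does not see the first coordinates. *)
have Ee a s b t : E (a, s) (b, t) = e s t.
  rewrite ((eqE _ _ _).2 (inclass a x s)).
  by apply/idP/idP => Est; rewrite /e ((eqE _ _ _).2 Est); apply: inclass.
have einv : invariant_rel H e.
  split=> [r s t|h Hh s t]; first exact: eqE.
  by move/(invE _ (top_perm_wreath G Hh)); rewrite !top_permE.
have [|h [Hh hu he]] := ppH e einv u v; first by rewrite -(Ee x u y v).
have [g Gg gx] := perm_transitive x y transG.
exists (fibre_perm u g * top_perm Gamma h); split=> [||[a t]].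
- by rewrite groupM ?fibre_perm_wreath ?top_perm_wreath.
- by rewrite permM fibre_permE eqxx top_permE gx hu.
by rewrite permM fibre_permE; case: ifP; rewrite top_permE Ee he.
Qed.

End PrePrimitiveWreath.

Theorem theorem2p13 (Gamma Delta : finType)
    (G : {group {perm Gamma}}) (H : {group {perm Delta}})
    (transG : [transitive G, on [set: Gamma] | 'P])
    (transH : [transitive H, on [set: Delta] | 'P]) :
  pre_primitive (wreath G H) <-> pre_primitive G /\ pre_primitive H.
Proof.
split=> [ppW|[ppG ppH]]; last exact: pre_primitive_wreath.
split; first exact: pre_primitive_wreath_base ppW.
exact: pre_primitive_wreath_top ppW.
Qed.
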